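(* There exist a global action of a finitely generated free group $\mathbb F$ on a zero-dimensional metrizable compact space $Z$ (by homeomorphisms), and a non-$\mathbb F$-paradoxical (with respect to $\mathbb K$) clopen subset $A$ of $Z$, such that $\mu(A)=\infty$ for every finitely additive $\mathbb F$-invariant measure $\mu\colon\mathbb K\to[0,\infty]$ such that $\mu(A)>0$, where $\mathbb K$ is the algebra of clopen subsets of $Z$.
   Context: For an action $\theta$ of a group $G$ on $Z$ by homeomorphisms, the type semigroup $S(Z,G,\mathbb K)$ is the set of classes $[A]$ of sets $A=\bigcup_{i=1}^nA_i\times\{i\}$, $A_i\in\mathbb K$, $n\in\mathbb N$, where $A\sim B$ iff there are $l\in\mathbb N$, $C_k\in\mathbb K$, $t_k\in G$, $n_k,m_k\in\mathbb N$ ($1\le k\le l$) with $A=\bigsqcup_kC_k\times\{n_k\}$ and $B=\bigsqcup_k\theta_{t_k}(C_k)\times\{m_k\}$. Addition: $[\bigcup_{i\le n}A_i\times\{i\}]+[\bigcup_{j\le m}B_j\times\{j\}]=[\bigcup_{i\le n}A_i\times\{i\}\cup\bigcup_{j\le m}B_j\times\{n+j\}]$. For $A\in\mathbb K$, $[A]$ denotes the class of $A\times\{1\}$. On this monoid $x\le y$ iff $x+z=y$ for some $z$. A set $A\in\mathbb K$ is $G$-paradoxical (with respect to $\mathbb K$) if $2[A]\le[A]$ in $S(Z,G,\mathbb K)$. *)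

(* Defs.v *)
From HB Require Import structures.
From mathcomp Require Import all_boot all_order all_algebra.
From mathcomp Require Import all_classical all_reals all_analysis.

Set Implicit Arguments.
Unset Strict Implicit.
Unset Printing Implicit Defensive.

Import GRing.Theory.

Local Open Scope classical_set_scope.
Local Open Scope quotient_scope.

(* A map between groups that preserves products is a group homomorphism. *)
Definition free_basis (F : groupType) (I : Type) (x : I -> F) : Prop :=
  forall (H : groupType) (f : I -> H),
    exists! phi : F -> H,
      (forall g h, phi (g * h)%g = (phi g * phi h)%g) /\
      (forall i, phi (x i) = f i).

Definition fg_free_group (F : groupType) : Prop :=
  exists (n : nat) (x : 'I_n -> F), free_basis x.

Definition metrizable (R : realType) (Z : topologicalType) : Prop :=
  exists (M : metricType R) (f : Z -> M) (g : M -> Z),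
    [/\ cancel f g, cancel g f, continuous f & continuous g].

(* The library's [zero_dimensional] only asks that clopen sets separate points;
   this is the usual, in general stronger, notion. *)
Definition clopen_basis (Z : topologicalType) : Prop :=
  basis [set U : set Z | clopen U].

(* Each [theta t] is a homeomorphism, its inverse being [theta t^-1]. *)
Record homeo_action (G : groupType) (Z : topologicalType) := HomeoAction {
  act_fun :> G -> Z -> Z;
  act1 : forall z, act_fun 1%g z = z;
  actM : forall s t z, act_fun (s * t)%g z = act_fun s (act_fun t z);
  act_continuous : forall t, continuous (act_fun t)
}.

Definition clopens (Z : topologicalType) := {U : set Z | `[< clopen U >]}.
HB.instance Definition _ (Z : topologicalType) := Choice.on (clopens Z).

Definition clopen_set (Z : topologicalType) (A : clopens Z) : set Z := sval A.
Coercion clopen_set : clopens >-> set.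

Lemma clopen_setP (Z : topologicalType) (A : clopens Z) : clopen (A : set Z).
Proof. by case: A => A /= /asboolP. Qed.

Definition mk_clopens (Z : topologicalType) (A : set Z) (cA : clopen A) :
  clopens Z := exist _ A (introT (asboolP _) cA).

Section TypeSemigroup.
Context (G : groupType) (Z : topologicalType) (theta : homeo_action G Z).

(* The set of all (z, i) such that z lies in the i-th term A_i of
   s = [:: A_1; ...; A_n]. *)
Definition stack (s : seq (clopens Z)) : set (Z * nat) :=
  \bigcup_(i in `I_(size s)) (nth set0 (map (@clopen_set Z) s) i `*` [set i.+1]).

Definition equidecomposable (X Y : set (Z * nat)) : Prop :=
  exists (l : nat) (C : 'I_l -> clopens Z) (t : 'I_l -> G) (n m : 'I_l -> nat),
    [/\ X = \bigcup_k (C k `*` [set n k]),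
        trivIset setT (fun k => C k `*` [set n k]),
        Y = \bigcup_k ((theta (t k) @` C k) `*` [set m k]) &
        trivIset setT (fun k => (theta (t k) @` C k) `*` [set m k])].

Lemma actK t : cancel (theta t) (theta t^-1%g).
Proof. by move=> z; rewrite -actM mulVg act1. Qed.

Lemma actVK t : cancel (theta t^-1%g) (theta t).
Proof. by move=> z; rewrite -actM mulgV act1. Qed.

Lemma act_inj t : injective (theta t).
Proof. exact: can_inj (actK t). Qed.

Lemma act_image t (A : set Z) : theta t @` A = theta t^-1%g @^-1` A.
Proof.
apply/seteqP; split => [z [y Ay <-]|z Az] /=; first by rewrite actK.
by exists (theta t^-1%g z) => //; rewrite actVK.
Qed.

Lemma act_imageP t (A : set Z) z :
  (theta t @` A) z <-> A (theta t^-1%g z).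
Proof. by rewrite act_image. Qed.

Lemma clopen_act_preimage t (A : set Z) : clopen A -> clopen (theta t @^-1` A).
Proof.
move=> [oA cA]; split.
  by apply: open_comp oA => z _; exact: act_continuous.
by apply: closed_comp cA => z _; exact: act_continuous.
Qed.

Lemma clopen_act_image t (A : set Z) : clopen A -> clopen (theta t @` A).
Proof. by rewrite act_image; exact: clopen_act_preimage. Qed.

Lemma equidecomposable_fin (I : finType) (C : I -> clopens Z) (t : I -> G)
    (n m : I -> nat) (X Y : set (Z * nat)) :
  (forall z i, X (z, i) <-> exists k, clopen_set (C k) z /\ i = n k) ->
  (forall k k' z, clopen_set (C k) z -> clopen_set (C k') z -> n k = n k' -> k = k') ->
  (forall z i, Y (z, i) <-> exists k, clopen_set (C k) (theta (t k)^-1%g z) /\ i = m k) ->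
  (forall k k' z, clopen_set (C k) (theta (t k)^-1%g z) ->
     clopen_set (C k') (theta (t k')^-1%g z) ->
     m k = m k' -> k = k') ->
  equidecomposable X Y.
Proof.
move=> XE Xt YE Yt; exists #|I|, (C \o enum_val), (t \o enum_val).
exists (n \o enum_val), (m \o enum_val); split.
- apply/seteqP; split => [[z i] /XE[k [Ck ->]]|[z i] [k _ [/= Ck ->]]].
    by exists (enum_rank k) => //; split => //=; rewrite enum_rankK.
  by apply/XE; exists (enum_val k).
- move=> k k' _ _ [[z i] [[/= Ck ik] [Ck' ik']]].
  by apply: enum_val_inj; apply: Xt Ck Ck' _; rewrite -ik -ik'.
- apply/seteqP; split => [[z i] /YE[k [Ck ->]]|[z i] [k _ [/act_imageP Ck /= ->]]].
    by exists (enum_rank k) => //; split; rewrite /= ?enum_rankK //;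
      apply/act_imageP.
  by apply/YE; exists (enum_val k).
- move=> k k' _ _ [[z i] [[/act_imageP Ck ik] [/act_imageP Ck' ik']]].
  by apply: enum_val_inj; apply: Yt Ck Ck' _; rewrite -[LHS]ik -[RHS]ik'.
Qed.

Lemma equidecomposableP (X Y : set (Z * nat)) : equidecomposable X Y ->
  exists (l : nat) (C : 'I_l -> clopens Z) (t : 'I_l -> G) (n m : 'I_l -> nat),
  [/\ forall z i, X (z, i) <-> exists k, clopen_set (C k) z /\ i = n k,
   forall k k' z, clopen_set (C k) z -> clopen_set (C k') z -> n k = n k' -> k = k',
   forall z i, Y (z, i) <-> exists k, clopen_set (C k) (theta (t k)^-1%g z) /\ i = m k &
   forall k k' z, clopen_set (C k) (theta (t k)^-1%g z) ->
     clopen_set (C k') (theta (t k')^-1%g z) ->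
     m k = m k' -> k = k'].
Proof.
move=> [l [C [t [n [m [-> Xt -> Yt]]]]]]; exists l, C, t, n, m; split.
- by move=> z i; split => [[k _ [/= ? ?]]|[k [? ?]]]; exists k.
- by move=> k k' z Ck Ck' nn; apply: Xt => //; exists (z, n k).
- move=> z i; split => [[k _ [/act_imageP ? /= ?]]|[k [? ?]]]; exists k => //.
  by split => //; apply/act_imageP.
- move=> k k' z Ck Ck' mm; apply: Yt => //; exists (z, m k).
  by split; split => //; apply/act_imageP.
Qed.

Lemma stackP (s : seq (clopens Z)) z i : stack s (z, i) <->
  exists k : 'I_(size s), clopen_set (tnth (in_tuple s) k) z /\ i = k.+1.
Proof.
split => [[k /= ks [/= Az ->]]|[k [Az ->]]].
  exists (Ordinal ks); split => //=; move: Az.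
  case: s ks => // A s ks.
  by rewrite (nth_map A) // (tnth_nth A).
exists k => //=; split => //=; move: Az; case: s k => [[]//|A s k].
by rewrite (nth_map A) // (tnth_nth A).
Qed.

Lemma equidecomposable_refl s : equidecomposable (stack s) (stack s).
Proof.
apply: (@equidecomposable_fin 'I_(size s) (tnth (in_tuple s)) (fun=> 1%g)
  (fun k => k.+1) (fun k => k.+1)).
- exact: stackP.
- by move=> k k' z _ _ [/val_inj].
- by move=> z i; rewrite invg1 act1; exact: stackP.
- by move=> k k' z _ _ [/val_inj].
Qed.

Lemma equidecomposable_sym X Y : equidecomposable X Y -> equidecomposable Y X.
Proof.
move=> /equidecomposableP[l [C [t [n [m [XE Xt YE Yt]]]]]].
pose D k := mk_clopens (clopen_act_image (t k) (clopen_setP (C k))).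
have DE k z : clopen_set (D k) z = clopen_set (C k) (theta (t k)^-1%g z).
  by rewrite /D [LHS]/clopen_set [sval _]/= act_image.
apply: (@equidecomposable_fin 'I_l D (fun k => (t k)^-1%g) m n).
- move=> z i; split => [/YE[k ?]|[k]]; first by exists k; rewrite DE.
  by rewrite DE => ?; apply/YE; exists k.
- by move=> k k' z; rewrite !DE; exact: Yt.
- move=> z i; split => [/XE[k ?]|[k]].
    by exists k; rewrite DE invgK actK.
  by rewrite DE invgK actK => ?; apply/XE; exists k.
- by move=> k k' z; rewrite !DE !invgK !actK; exact: Xt.
Qed.

Lemma equidecomposable_trans X Y W :
  equidecomposable X Y -> equidecomposable Y W -> equidecomposable X W.
Proof.
move=> /equidecomposableP[l [C [t [n [m [XE Xt YE Yt]]]]]].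
move=> /equidecomposableP[l' [D [u [p [q [YE' Yt' WE Wt]]]]]].
have cE (k : 'I_l * 'I_l') : clopen (if m k.1 == p k.2
    then clopen_set (C k.1) `&` theta (t k.1) @^-1` D k.2 else set0).
  case: ifP => _; last by split; [exact: open0|exact: closed0].
  have [oC cC] := clopen_setP (C k.1).
  have [oD cD] := clopen_act_preimage (t k.1) (clopen_setP (D k.2)).
  by split; [exact: openI|exact: closedI].
pose E k := mk_clopens (cE k).
have EP k z : clopen_set (E k) z <->
    [/\ m k.1 = p k.2, clopen_set (C k.1) z & clopen_set (D k.2) (theta (t k.1) z)].
  rewrite /E /clopen_set /=; case: eqP => mp; last by split => // -[].
  by split => [[]|[]].
have tV k z : theta (u k.2 * t k.1)^-1%g z =
    theta (t k.1)^-1%g (theta (u k.2)^-1%g z).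
  by move: k => [? ?] /=; rewrite invgM actM.
apply: (@equidecomposable_fin _ E (fun k => u k.2 * t k.1)%g
  (fun k => n k.1) (fun k => q k.2)).
- move=> z i; split => [Xzi|[[k k'] [/EP[/= _ Ck _] ->]]]; last first.
    by apply/XE; exists k.
  have [k [Ck ik]] := (XE z i).1 Xzi.
  have /YE'[k' [Dk' mk]] : Y (theta (t k) z, m k).
    by apply/YE; exists k; rewrite actK.
  by exists (k, k'); split => //; apply/EP.
- move=> [k k'] [j j'] z /EP + /EP; move=> [/= mp Ck Dk] [/= mp' Cj Dj] nn.
  have kj := Xt _ _ _ Ck Cj nn; subst j.
  by congr pair; apply: Yt' Dk Dj _; rewrite -mp -mp'.
- move=> z i; split => [/WE[k' [Dk' ->]]|[[k k']]]; last first.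
    rewrite tV => -[/EP[/= _ _]]; rewrite actVK => Dk' ->.
    by apply/WE; exists k'.
  have /YE[k [Ck pm]] : Y (theta (u k')^-1%g z, p k') by apply/YE'; exists k'.
  by exists (k, k'); split => //; apply/EP; rewrite tV /= actVK.
- move=> [k k'] [j j'] z; rewrite !tV => /EP + /EP; move=> [/= mp + +] [/= mp' + +].
  rewrite !actVK => Ck Dk Cj Dj qq.
  have kj := Wt _ _ _ Dk Dj qq; subst j'.
  by congr pair; apply: Yt Ck Cj _; rewrite mp mp'.
Qed.

Definition equidec (s r : seq (clopens Z)) : bool :=
  `[< equidecomposable (stack s) (stack r) >].

Lemma equidec_refl : reflexive equidec.
Proof. by move=> s; apply/asboolP; exact: equidecomposable_refl. Qed.

Lemma equidec_sym : symmetric equidec.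
Proof.
by move=> s r; apply/asboolP/asboolP; exact: equidecomposable_sym.
Qed.

Lemma equidec_trans : transitive equidec.
Proof.
move=> r s v /asboolP sr /asboolP rv; apply/asboolP.
exact: equidecomposable_trans rv.
Qed.

Canonical equidec_equiv := EquivRel equidec equidec_refl equidec_sym equidec_trans.

Lemma stack_cat s r z i : stack (s ++ r) (z, i) <->
  stack s (z, i) \/ exists j, stack r (z, j) /\ i = (size s + j)%N.
Proof.
rewrite /stack map_cat; split.
  move=> [k /=]; rewrite size_cat nth_cat size_map => ks [/=].
  case: ltnP => [ks' Az ->|sk Az ->]; first by left; exists k.
  right; exists (k - size s).+1; split; last by rewrite addnS subnKC.
  by exists (k - size s)%N => //=; rewrite ltn_subLR.
case=> [[k /= ks [/= Az ->]]|[j [[k /= kr [/= Az ->]] ->]]].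
  exists k => /=; first by rewrite size_cat ltn_addr.
  by rewrite nth_cat size_map ks.
exists (size s + k)%N => /=; first by rewrite size_cat ltn_add2l.
by rewrite nth_cat size_map ltnNge leq_addr /= addKn addnS.
Qed.

Lemma stack_level s z i : stack s (z, i) -> (0 < i <= size s)%N.
Proof. by move=> [k /= ks [_ /= ->]]. Qed.

Lemma equidec_cat s s' r r' :
  equidec s s' -> equidec r r' -> equidec (s ++ r) (s' ++ r').
Proof.
move=> /asboolP /equidecomposableP[l [C [t [n [m [XE Xt YE Yt]]]]]].
move=> /asboolP /equidecomposableP[l' [D [u [p [q [XE' Xt' YE' Yt']]]]]].
apply/asboolP.
have lX k z : clopen_set (C k) z -> (0 < n k <= size s)%N.
  by move=> Ck; apply: (@stack_level s z); apply/XE; exists k.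
have lX' k z : clopen_set (D k) z -> (0 < p k)%N.
  move=> Dk; have /stack_level/andP[] // : stack r (z, p k).
  by apply/XE'; exists k.
have lY k z : clopen_set (C k) (theta (t k)^-1%g z) -> (0 < m k <= size s')%N.
  by move=> Ck; apply: (@stack_level s' z); apply/YE; exists k.
have lY' k z : clopen_set (D k) (theta (u k)^-1%g z) -> (0 < q k)%N.
  move=> Dk; have /stack_level/andP[] // : stack r' (z, q k).
  by apply/YE'; exists k.
have no a b c : (0 < a <= b -> 0 < c -> a = b + c -> False)%N.
  by move=> /andP[_ ab] c0 E; move: ab; rewrite E -{2}[b]addn0 leq_add2l leqNgt c0.
apply: (@equidecomposable_fin ('I_l + 'I_l')%type
  (fun k => match k with inl k => C k | inr k => D k end)
  (fun k => match k with inl k => t k | inr k => u k end)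
  (fun k => match k with inl k => n k | inr k => size s + p k end)%N
  (fun k => match k with inl k => m k | inr k => size s' + q k end)%N).
- move=> z i; split => [/stack_cat[/XE[k ?]|[j [/XE'[k [? ->]] ->]]]|[[k|k]]].
  + by exists (inl k).
  + by exists (inr k).
  + by move=> ?; apply/stack_cat; left; apply/XE; exists k.
  + move=> [? ->]; apply/stack_cat; right; exists (p k); split => //.
    by apply/XE'; exists k.
- move=> [k|k] [k'|k'] z A B.
  + by move=> E; congr inl; exact: (Xt _ _ _ A B E).
  + by move=> E; case: (no _ _ _ (lX _ _ A) (lX' _ _ B) E).
  + by move=> E; case: (no _ _ _ (lX _ _ B) (lX' _ _ A) (esym E)).
  + by move=> /addnI E; congr inr; exact: (Xt' _ _ _ A B E).
- move=> z i; split => [/stack_cat[/YE[k ?]|[j [/YE'[k [? ->]] ->]]]|[[k|k]]].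
  + by exists (inl k).
  + by exists (inr k).
  + by move=> ?; apply/stack_cat; left; apply/YE; exists k.
  + move=> [? ->]; apply/stack_cat; right; exists (q k); split => //.
    by apply/YE'; exists k.
- move=> [k|k] [k'|k'] z A B.
  + by move=> E; congr inl; exact: (Yt _ _ _ A B E).
  + by move=> E; case: (no _ _ _ (lY _ _ A) (lY' _ _ B) E).
  + by move=> E; case: (no _ _ _ (lY _ _ B) (lY' _ _ A) (esym E)).
  + by move=> /addnI E; congr inr; exact: (Yt' _ _ _ A B E).
Qed.

Lemma equidec_catC s r : equidec (s ++ r) (r ++ s).
Proof.
apply/asboolP.
have no a b c : (a < b -> a.+1 = b + c.+1 -> False)%N.
  by move=> ab; rewrite addnS => -[E]; move: ab; rewrite E ltnNge leq_addr.
apply: (@equidecomposable_fin ('I_(size s) + 'I_(size r))%type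
  (fun k => match k with
    inl k => tnth (in_tuple s) k | inr k => tnth (in_tuple r) k end)
  (fun=> 1%g)
  (fun k => match k with inl k => k.+1 | inr k => size s + k.+1 end)%N
  (fun k => match k with inl k => size r + k.+1 | inr k => k.+1 end)%N).
- move=> z i; split => [/stack_cat[/stackP[k ?]|[j [/stackP[k [? ->]] ->]]]|[[k|k]]].
  + by exists (inl k).
  + by exists (inr k).
  + by move=> ?; apply/stack_cat; left; apply/stackP; exists k.
  + move=> [? ->]; apply/stack_cat; right; exists k.+1; split => //.
    by apply/stackP; exists k.
- move=> [k|k] [k'|k'] z _ _.
  + by move=> [/val_inj ->].
  + by move=> E; case: (no _ _ _ (ltn_ord k) E).
  + by move=> E; case: (no _ _ _ (ltn_ord k') (esym E)).
  + by move=> /addnI [/val_inj ->].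
- move=> z i; rewrite invg1 act1.
  split => [/stack_cat[/stackP[k ?]|[j [/stackP[k [? ->]] ->]]]|[[k|k]]].
  + by exists (inr k).
  + by exists (inl k).
  + move=> [? ->]; apply/stack_cat; right; exists k.+1; split => //.
    by apply/stackP; exists k.
  + by move=> ?; apply/stack_cat; left; apply/stackP; exists k.
- move=> [k|k] [k'|k'] z _ _.
  + by move=> /addnI [/val_inj ->].
  + by move=> E; case: (no _ _ _ (ltn_ord k') (esym E)).
  + by move=> E; case: (no _ _ _ (ltn_ord k) E).
  + by move=> [/val_inj ->].
Qed.

Definition type_semigroup := {eq_quot equidec}.
HB.instance Definition _ := Choice.on type_semigroup.
HB.instance Definition _ := EqQuotient.on type_semigroup.

Definition ts_class (s : seq (clopens Z)) : type_semigroup :=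
  (\pi_type_semigroup s)%qT.

Definition ts_add : type_semigroup -> type_semigroup -> type_semigroup :=
  lift_op2 type_semigroup cat.

Lemma ts_classP s r :
  ts_class s = ts_class r <-> equidecomposable (stack s) (stack r).
Proof. by split=> [/eqmodP/asboolP|H]; [|apply/eqmodP/asboolP]. Qed.

Lemma ts_addE s r : ts_add (ts_class s) (ts_class r) = ts_class (s ++ r).
Proof.
by rewrite /ts_add; unlock; apply/eqmodP; apply: equidec_cat; apply/eqmodP;
  rewrite reprK.
Qed.

Lemma ts_class_repr x : ts_class (repr x) = x.
Proof. exact: reprK. Qed.

Lemma ts_addA : associative ts_add.
Proof.
move=> x y z; rewrite -(ts_class_repr x) -(ts_class_repr y) -(ts_class_repr z).
by rewrite !ts_addE catA.
Qed.

Lemma ts_addC : commutative ts_add.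
Proof.
move=> x y; rewrite -(ts_class_repr x) -(ts_class_repr y) !ts_addE.
exact/eqmodP/equidec_catC.
Qed.

Lemma ts_add0 : left_id (ts_class [::]) ts_add.
Proof. by move=> x; rewrite -(ts_class_repr x) ts_addE. Qed.

HB.instance Definition _ :=
  GRing.isNmodule.Build type_semigroup ts_addA ts_addC ts_add0.

Definition ts_le (x y : type_semigroup) : Prop := exists z, (x + z)%R = y.

Definition paradoxical (A : clopens Z) : Prop :=
  ts_le (ts_class [:: A] *+ 2)%R (ts_class [:: A]).

End TypeSemigroup.

Definition clopen_display : measure_display.
Proof. exact. Qed.

(* [Z] equipped with its algebra of clopen sets; a finitely additive measure
   on that algebra is then a [content] on this type. *)
Definition clopen_algebra (Z : ptopologicalType) : Type := Z.

Section ClopenAlgebra.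
Context (Z : ptopologicalType).

Let clopen_set0 : clopen (set0 : set Z).
Proof. by split; [exact: open0|exact: closed0]. Qed.

Let clopen_setU : setU_closed [set U : set Z | clopen U].
Proof. by move=> A B [oA cA] [oB cB]; split; [exact: openU|exact: closedU]. Qed.

Let clopen_setC : setC_closed [set U : set Z | clopen U].
Proof. by move=> A [oA cA]; split; [exact: closed_openC|exact: open_closedC]. Qed.

HB.instance Definition _ := Pointed.on (clopen_algebra Z).
HB.instance Definition _ := isAlgebraOfSets.Build clopen_display
  (clopen_algebra Z) clopen_set0 clopen_setU clopen_setC.
End ClopenAlgebra.

Definition invariant_content (R : realType) (G : groupType) (Z : ptopologicalType)
    (theta : homeo_action G Z)
    (mu : {content set (clopen_algebra Z) -> \bar R}%R) : Prop :=
  forall (t : G) (U : set Z), clopen U -> mu (theta t @` U) = mu U.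

(* Main.v *)
Require Import Defs.
From HB Require Import structures.
From mathcomp Require Import all_boot all_order all_algebra.
From mathcomp Require Import all_classical all_reals all_analysis.
From mathcomp Require Import zify lra.

Set Implicit Arguments.
Unset Strict Implicit.
Unset Printing Implicit Defensive.

(** The space consists of infinite trees. Every vertex has five slots, each
    slot carries exactly one edge, and an edge joins a slot in {0, 1} to a slot
    in {2, 3, 4}; a point of the space is such a tree with a base slot at a base
    vertex. The free group of rank two acts through two homeomorphisms: [flip]
    moves the base slot to the other end of its edge, [turn] moves it to the
    next slot of the same vertex. Let A be the clopen set of the points with
    base slot 0. Turning identifies the classes of the five sets given by the
    value of the base slot, and flipping exchanges the points with base slot in
    {0, 1} and those with base slot in {2, 3, 4}. Therefore 2[A] = 3[A], and
    an invariant measure that is finite on A vanishes on A.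

    The space is the inverse limit of finite stages: the vertices of a stage are
    balls in such trees, all of the same radius. A finite union of stacked
    clopen sets is, up to equidecomposability, a function with natural values on
    the (vertex, slot) pairs of some stage, and two such functions have the same
    class as soon as they have the same sum over the slots of each vertex
    ([turn]) or the same sum over the two ends of each edge ([flip]). To see
    that 2[A] <= [A] fails, one describes the functions in the class of A. The
    predicate [unit_class n] does so by recursion on the stage n: a function psi
    of the vertices of stage n + 1 qualifies when it is a sum over the slots of
    charges r, where the charges at the two ends of an edge add up to the
    charges there of a function a of stage n, and the sum of a over the slots
    qualifies at stage n. At stage 0 there is a single vertex and psi must have
    the value 1.

    This predicate is compatible with the flip ([unit_class_exchangeable])
    because a vertex of stage n + 1 is a vertex of stage n together with five
    independent choices, one edge for each slot. A sum of functions of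
    independent variables determines its summands up to constants, and since all
    the values are natural numbers, constants can be moved from one slot to
    another with nonnegative results; the effect at stage n of moving them is
    harmless by induction. At stage 0 one checks that a charge of total 1
    cannot be changed at all: it takes both slots 0 and 1, or all three slots
    2, 3 and 4, to move anything across. For the same reason every part of psi
    that comes from stage n can be split off ([peel_roots]). Hence a qualifying
    function of the form 2 + chi would go down to stage 0 and give an equation
    2 + k = 1 ([not_unit_class_ge2]). If A were paradoxical, then moving the
    finitely many pieces one after the other ([action_unital_sum]) would turn
    the indicator of A, which is in the class, into a function of this form.

    In algebraic terms, the monoid generated by a with the relation 2a = 3a
    embeds in the type semigroup, and the order of the latter restricts to the
    order of the former. *)

(** * Finite stages *)

Notation slot := 'I_5.

(** [adj p q] means that an edge may join slot p.2 of a vertex of type p.1 to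
    slot q.2 of a vertex of type q.1. By [adj_block] this relation is a disjoint
    union of complete bipartite blocks: an edge already present in the preceding
    stage fixes a block, and its two ends extend independently. *)
Record stage := Stage {
  node : finType;
  adj : rel (node * slot);
  adj_sym : symmetric adj;
  adj_block : forall p p' q q', adj p q -> adj p' q -> adj p q' -> adj p' q';
  adj_ex : forall p, exists q, adj p q
}.

Definition slot_sum (V : Type) (a : V * slot -> nat) (v : V) : nat :=
  \sum_i a (v, i).

(** Invariance of a class under the flip, read on functions of vertices: only
    the sums over the two ends of each edge matter. *)
Definition exchangeable (S : stage) (G : (node S -> nat) -> Prop) : Prop :=
  forall a a' : node S * slot -> nat,
    (forall p q, adj p q -> a p + a q = a' p + a' q) ->
    G (slot_sum a) -> G (slot_sum a').

(** A ball of the next stage adds to its central ball, for each slot, the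
    (vertex, slot) pair at the other end of the edge; the five choices are
    independent. *)
Definition next_node (S : stage) : finType :=
  {vf : node S * {ffun slot -> node S * slot} |
    [forall i, adj (vf.1, i) (vf.2 i)]}.

Definition root (S : stage) (V : next_node S) : node S := (val V).1.

Definition trunc (S : stage) (P : next_node S * slot) : node S * slot :=
  (root P.1, P.2).

(** The value of the flip, known with a precision of one stage less. *)
Definition cross (S : stage) (P : next_node S * slot) : node S * slot :=
  (val P.1).2 P.2.

Definition next_adj (S : stage) : rel (next_node S * slot) :=
  [rel P Q | (cross P == trunc Q) && (cross Q == trunc P)].

Lemma adj_cross (S : stage) (P : next_node S * slot) :
  adj (trunc P) (cross P).
Proof. by case: P => [[[v f] vfP] i]; have /forallP := vfP; apply. Qed.

Lemma next_node_extend (S : stage) (v : node S) (f : slot -> node S * slot) :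
  (forall i, adj (v, i) (f i)) ->
  exists2 V : next_node S, root V = v & forall i, cross (V, i) = f i.
Proof.
move=> vf; have vfP : [forall i, adj ((v, [ffun i => f i]).1, i)
    ((v, [ffun i => f i]).2 i)].
  by apply/forallP => i; rewrite /= ffunE.
by exists (exist _ (v, [ffun i => f i]) vfP) => // i; rewrite /cross /= ffunE.
Qed.

Lemma adj_extend (S : stage) (p q : node S * slot) : adj p q ->
  exists2 P : next_node S * slot, trunc P = p & cross P = q.
Proof.
move=> pq; pose f i := if (p.1, i) == p then q else xchoose (adj_ex (p.1, i)).
have [|V Vp Vf] := @next_node_extend S p.1 f.
  by move=> i; rewrite /f; case: eqP => [->//|_]; exact: xchooseP.
exists (V, p.2); first by rewrite /trunc Vp -surjective_pairing.
by rewrite Vf /f -surjective_pairing eqxx.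
Qed.

Lemma next_adj_sym (S : stage) : symmetric (@next_adj S).
Proof. by move=> P Q; rewrite /next_adj /= andbC. Qed.

Lemma next_adj_block (S : stage) (P P' Q Q' : next_node S * slot) :
  next_adj P Q -> next_adj P' Q -> next_adj P Q' -> next_adj P' Q'.
Proof.
rewrite /next_adj /= => /andP[/eqP PQ /eqP QP] /andP[/eqP P'Q /eqP QP'].
by move=> /andP[/eqP PQ' /eqP Q'P]; rewrite P'Q -PQ PQ' Q'P -QP QP' !eqxx.
Qed.

Lemma next_adj_ex (S : stage) (P : next_node S * slot) :
  exists Q, next_adj P Q.
Proof.
have [|Q QP PQ] := @adj_extend S (cross P) (trunc P).
  by rewrite adj_sym adj_cross.
by exists Q; rewrite /next_adj /= QP PQ !eqxx.
Qed.

Definition next (S : stage) : stage :=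
  Stage (@next_adj_sym S) (@next_adj_block S) (@next_adj_ex S).

(** The charges r of psi and the charges a of the coarser stage agree on the
    edges. The extra summand nu collects what has already been split off. *)
Definition refines_over (S : stage) (G : (node S -> nat) -> Prop)
    (nu : node S -> nat) (psi : node (next S) -> nat) : Prop :=
  exists (r : node S * slot -> node S * slot -> nat) (a : node S * slot -> nat),
  [/\ forall V, psi V = \sum_i r (trunc (V, i)) (cross (V, i)),
      forall p q, adj p q -> r p q + r q p = a p + a q &
      G (fun v => nu v + slot_sum a v)].

Definition refined (S : stage) (G : (node S -> nat) -> Prop) :=
  refines_over G (fun=> 0).

Lemma sum_slot_eq (V : eqType) (w v : V) (i : slot) :
  \sum_j ((w, j) == (v, i)) = (w == v).
Proof.
rewrite (bigD1 i) //= big1 ?addn0 => [|j /negPf ji].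
  by rewrite xpair_eqE eqxx andbT.
by rewrite xpair_eqE ji andbF.
Qed.

(** The variables of the summands are independent: if every summand could
    vanish, then so would their sum. *)
Lemma sum_gt0_summand (I T : finType) (D : I -> pred T) (r : I -> T -> nat) :
  (forall f : I -> T, (forall i, D i (f i)) -> 0 < \sum_i r i (f i)) ->
  exists i, forall q, D i q -> 0 < r i q.
Proof.
move=> H; apply: contrapT => /forallNP N.
have {}N i : exists q, D i q && (r i q == 0).
  have /existsNP[q /not_implyP[Dq /negP rq]] := N i.
  by exists q; rewrite Dq -leqn0 leqNgt.
have /H := fun i => proj1 (andP (xchooseP (N i))).
by rewrite big1 // => i _; have /andP[_ /eqP] := xchooseP (N i).
Qed.

(** * Going up one stage *)

Section Step.
Variables (S : stage) (G : (node S -> nat) -> Prop).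
Hypothesis exG : exchangeable G.
Implicit Types (a : node S * slot -> nat) (nu : node S -> nat).
Implicit Types (psi : node (next S) -> nat).

Lemma exchangeable_over nu a a' :
  (forall p q, adj p q -> a p + a q = a' p + a' q) ->
  G (fun v => nu v + slot_sum a v) -> G (fun v => nu v + slot_sum a' v).
Proof.
move=> aa'; pose b c (p : node S * slot) := c p + ((p.2 == ord0) * nu p.1).
have bE c : (fun v => nu v + slot_sum c v) = slot_sum (b c).
  apply/funext => v; rewrite /slot_sum /b big_split /= addnC; congr addn.
  by rewrite (bigD1 ord0) //= mul1n big1 ?addn0 // => i /negPf ->.
rewrite !bE; apply: exG => p q /aa' E.
by rewrite /b addnACA E addnACA.
Qed.

(** If no edge at p is without charge, then the charges can be arranged to be
    positive at p itself. Otherwise all the ends opposite to p are charged, and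
    a unit of charge crosses every edge of the block of p. *)
Lemma charge_gt0 nu a p :
  (forall q, adj p q -> 0 < a p + a q) -> G (fun v => nu v + slot_sum a v) ->
  exists a', [/\ 0 < a' p, forall x y, adj x y -> a' x + a' y = a x + a y &
    G (fun v => nu v + slot_sum a' v)].
Proof.
move=> ap Ga; have [p0|] := ltnP 0 (a p); first by exists a.
rewrite leqn0 => /eqP p0.
(* The block of p on the side of p. *)
pose sim x := [exists q, adj p q && adj x q].
have simE x y : adj x y -> sim x = adj p y.
  move=> xy; apply/existsP/idP => [[q /andP[pq xq]]|py]; last first.
    by exists y; rewrite py.
  exact: adj_block xq pq xy.
have adj_gt0 x : adj p x -> 0 < a x by move/ap; rewrite p0.
pose a' x := a x + sim x - adj p x.
have aa' x y : adj x y -> a' x + a' y = a x + a y.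
  move=> xy; have sy := simE y x; rewrite adj_sym in sy.
  rewrite /a' (simE _ _ xy) (sy xy).
  by have := adj_gt0 x; have := adj_gt0 y; lia.
exists a'; split => //; last by apply: exchangeable_over Ga => x y /aa' ->.
have [q pq] := adj_ex p; rewrite /a' (simE _ _ pq) pq p0.
suff /negPf-> : ~~ adj p p by [].
by apply/negP => /ap; rewrite p0.
Qed.

(** The sum of the charges r is at least 1 on all the balls with centre v, so
    that some slot of v has a positive charge towards all its neighbours. By
    [charge_gt0] this unit can be removed from a as well, and it joins nu. *)
Lemma peel_root nu psi v :
  refines_over G nu (fun V => (root V == v) + psi V) ->
  refines_over G (fun w => nu w + (w == v)) psi.
Proof.
move=> [r [a [rE ra Ga]]].
have [i ri] : exists i, forall q, adj (v, i) q -> 0 < r (v, i) q.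
  apply: sum_gt0_summand => f /next_node_extend[V Vv Vf].
  have := rE V; rewrite Vv eqxx => E.
  suff <- : \sum_j r (trunc (V, j)) (cross (V, j)) = \sum_j r (v, j) (f j).
    by rewrite -E.
  by apply: eq_bigr => j _; rewrite Vf /trunc Vv.
have [a' [ai aa' Ga']] : exists a', [/\ 0 < a' (v, i),
    forall x y, adj x y -> a' x + a' y = a x + a y &
    G (fun v => nu v + slot_sum a' v)].
  by apply: charge_gt0 Ga => q vq; rewrite -ra // addn_gt0 ri.
exists (fun p q => r p q - (p == (v, i))), (fun p => a' p - (p == (v, i))).
split.
- move=> V; apply: (@addnI (root V == v)); rewrite rE -(sum_slot_eq _ _ i).
  rewrite -big_split; apply: eq_bigr => j _ /=; rewrite subnKC //.
  by case: eqP => // E; have := adj_cross (V, j); rewrite /trunc /= E => /ri.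
- move=> p q pq; have := aa' _ _ pq; rewrite -(ra _ _ pq) => E.
  have rp : (p == (v, i)) <= r p q by case: eqP pq => // -> /ri.
  have rq : (q == (v, i)) <= r q p.
    by case: eqP pq => // ->; rewrite adj_sym => /ri.
  have ap : (p == (v, i)) <= a' p by case: eqP => // ->.
  have aq : (q == (v, i)) <= a' q by case: eqP => // ->.
  by move: rp rq ap aq E; lia.
- congr G: Ga'; apply/funext => w /=; rewrite -addnA; congr addn.
  rewrite -(sum_slot_eq _ _ i) -big_split; apply: eq_bigr => j _ /=.
  by rewrite subnKC //; case: eqP => // ->.
Qed.

Lemma peel_roots nu (mu : node S -> nat) psi :
  refines_over G nu (fun V => mu (root V) + psi V) ->
  refines_over G (fun w => nu w + mu w) psi.
Proof.
have [n] := ubnP (\sum_v mu v); elim: n => // n IHn in nu mu *.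
have [[v v0] mun|mu0 _] := pselect (exists v, 0 < mu v); last first.
  have {}mu0 w : mu w = 0.
    by apply/eqP; rewrite -leqn0 leqNgt; apply/negP => w0; apply: mu0; exists w.
  have -> : (fun V => mu (root V) + psi V) = psi.
    by apply/funext => V; rewrite mu0.
  by congr refines_over; apply/funext => w; rewrite mu0 addn0.
pose mu' w := mu w - (w == v).
have muE w : mu w = (w == v) + mu' w.
  by rewrite /mu' subnKC //; case: eqP => // ->.
have -> : (fun V => mu (root V) + psi V) =
    (fun V => (root V == v) + (mu' (root V) + psi V)).
  by apply/funext => V; rewrite addnA -muE.
move=> /peel_root/IHn; have -> : (fun w => nu w + (w == v) + mu' w) =
    (fun w => nu w + mu w).
  by apply/funext => w; rewrite muE addnA.
apply; rewrite ltnS in mun; apply: leq_trans mun.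
rewrite [leqRHS](eq_bigr _ (fun w _ => muE w)) big_split /=.
by rewrite [X in X + _](bigD1 v) //= eqxx -addnA add1n ltnS leq_addl.
Qed.

(** An edge between p and q splits into a block of edges of the next stage;
    replacing [slab p q] by [slab q p] flips one unit along this block. *)
Definition slab (p q : node S * slot) (V : node (next S)) : nat :=
  \sum_i ((trunc (V, i) == p) && (cross (V, i) == q)).

(** A unit on a slab can be charged to the edge of this slab: if r p q = 0, then
    the unit is charged, for every choice of the other edges, to some other slot
    of the same vertex, and it moves from there to the slot of p without
    changing any sum over slots. *)
Lemma peel_slab psi p q : adj p q ->
  refined G (fun V => psi V + slab p q V) ->
  exists r a,
  [/\ forall V, psi V + slab p q V = \sum_i r (trunc (V, i)) (cross (V, i)),
      forall p q, adj p q -> r p q + r q p = a p + a q,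
      G (slot_sum a) & 0 < r p q].
Proof.
move=> pq [r [a [rE ra Ga]]].
have [r0|] := ltnP 0 (r p q); first by exists r, a.
rewrite leqn0 => /eqP r0.
(* The edge at the slot of p is prescribed, the others are free. *)
pose D i x := if i == p.2 then x == q else adj (p.1, i) x.
have [i ri] : exists i, forall x, D i x -> 0 < r (p.1, i) x.
  apply: sum_gt0_summand => f Df.
  have [|V Vp Vf] := @next_node_extend S p.1 f.
    move=> i; have := Df i; rewrite /D; case: eqP => // -> /eqP ->.
    by rewrite -surjective_pairing.
  have slab1 : 0 < slab p q V.
    rewrite /slab (bigD1 p.2) //= /trunc Vp Vf /= -surjective_pairing eqxx.
    by have := Df p.2; rewrite /D eqxx => /eqP ->; rewrite eqxx.
  suff <- : \sum_j r (trunc (V, j)) (cross (V, j)) = \sum_j r (p.1, j) (f j).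
    by rewrite -rE addn_gt0 slab1 orbT.
  by apply: eq_bigr => j _; rewrite Vf /trunc Vp.
have ip : i == p.2 = false.
  apply/eqP => E; have := ri q; rewrite /D E eqxx -surjective_pairing r0.
  by move=> /(_ (eqxx _)).
have {}ri x : adj (p.1, i) x -> 0 < r (p.1, i) x by move: (ri x); rewrite /D ip.
have pi : p == (p.1, i) = false.
  by apply/eqP => E; rewrite E eqxx in ip.
have [a' [ai aa' Ga']] : exists a', [/\ 0 < a' (p.1, i),
    forall x y, adj x y -> a' x + a' y = a x + a y &
    G (fun v => 0 + slot_sum a' v)].
  by apply: charge_gt0 Ga => x px; rewrite -ra // addn_gt0 ri.
have sumE (b : slot -> nat) (w : node S) :
    (forall j, (w, j) == (p.1, i) -> 0 < b j) ->
    \sum_j (b j - ((w, j) == (p.1, i)) + ((w, j) == p)) = \sum_j b j.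
  have pE : \sum_j ((w, j) == p) = \sum_j ((w, j) == (p.1, i)).
    have := sum_slot_eq w p.1 p.2.
    by rewrite -surjective_pairing -(sum_slot_eq _ _ i).
  move=> b0; rewrite big_split /= pE -big_split; apply: eq_bigr => j _.
  by rewrite /= subnK //; case: eqP (b0 j) => // _ /(_ isT).
exists (fun x y => r x y - (x == (p.1, i)) + (x == p)).
exists (fun x => a' x - (x == (p.1, i)) + (x == p)); split.
- move=> V; rewrite rE /trunc sumE // => j /eqP E.
  by have := adj_cross (V, j); rewrite /trunc E => /ri.
- move=> x y xy; have := aa' _ _ xy; rewrite -(ra _ _ xy) => E.
  have rp : (x == (p.1, i)) <= r x y by case: eqP xy => // -> /ri.
  have rq : (y == (p.1, i)) <= r y x.
    by case: eqP xy => // ->; rewrite adj_sym => /ri.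
  have ap : (x == (p.1, i)) <= a' x by case: eqP => // ->.
  have aq : (y == (p.1, i)) <= a' y by case: eqP => // ->.
  by move: rp rq ap aq E; lia.
- congr G: Ga'; apply/funext => w; rewrite add0n /slot_sum sumE // => j.
  by move=> /eqP ->.
- by rewrite eqxx pi addn1.
Qed.

(** Once the unit is charged to the edge between p and q, moving it to the other
    end of this edge preserves the sum of r over the edge. *)
Lemma swap_slab psi p q : adj p q ->
  refined G (fun V => psi V + slab p q V) ->
  refined G (fun V => psi V + slab q p V).
Proof.
move=> pq /(peel_slab pq)[r [a [rE ra Ga r0]]].
exists (fun x y => r x y - ((x == p) && (y == q)) + ((x == q) && (y == p))), a.
have rpq x y : (x == p) && (y == q) <= r x y.
  by case: andP => // -[/eqP-> /eqP->].
split=> [V|x y xy|].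
- rewrite big_split /=; congr addn; apply: (@addIn (slab p q V)).
  by rewrite rE -big_split; apply: eq_bigr => j _; rewrite /= subnK.
- have := ra _ _ xy; have := rpq x y; have := rpq y x.
  by rewrite ![(y == _) && _]andbC; lia.
- exact: Ga.
Qed.

(** Two functions with the same sums over edges differ, on each block, by a
    constant on one end and its opposite on the other. The difference is removed
    unit by unit, each unit being a swap of two slabs; the intermediate
    functions keep natural values. *)
Lemma refined_exchangeable : @exchangeable (next S) (refined G).
Proof.
move=> a a'.
(* The truncated difference counts the units that remain to be moved. *)
have [n] := ubnP (\sum_P (a P - a' P)).
elim: n => // n IHn in a *; move=> an aa' Ga.
have [[P Pa]|aLe] := pselect (exists P, a' P < a P); last first.
  suff -> : a' = a by [].
  apply/funext => P; have [Q PQ] := @adj_ex (next S) P.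
  have le X : a X <= a' X.
    by rewrite leqNgt; apply/negP => Xa; apply: aLe; exists X.
  by have := aa' _ _ PQ; have := le P; have := le Q; lia.
pose p := trunc P; pose q := cross P.
have pq : adj p q := adj_cross P.
pose B (X : next_node S * slot) := (trunc X == p) && (cross X == q).
pose B' (X : next_node S * slot) := (trunc X == q) && (cross X == p).
have BB' X Y : B X -> B' Y -> @adj (next S) X Y.
  rewrite /B /B' /= /next_adj /= => /andP[/eqP-> /eqP->] /andP[/eqP-> /eqP->].
  by rewrite !eqxx.
have BP : B P by rewrite /B !eqxx.
have B'lt Y : B' Y -> a Y < a' Y by move=> /(BB' _ _ BP)/aa'; lia.
have [Y0 Y0q Y0p] : exists2 Y, trunc Y = q & cross Y = p.
  by apply: adj_extend; rewrite adj_sym.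
have B'Y0 : B' Y0 by rewrite /B' Y0q Y0p !eqxx.
have Blt X : B X -> a' X < a X.
  by move=> /BB'/(_ B'Y0)/aa'; have := B'lt _ B'Y0; lia.
pose a1 X := a X - B X + B' X.
have Ba X : B X <= a X by case: (B X) (Blt X) => // /(_ isT); lia.
have BE X Y : @adj (next S) X Y -> B X = B' Y.
  by move=> /andP[/eqP XY /eqP YX]; rewrite /B /B' -YX XY andbC.
apply: (IHn a1).
- rewrite -ltnS; apply: leq_trans an; rewrite ltnS.
  rewrite (bigD1 P) //= [ltnRHS](bigD1 P) //= -addSn leq_add //.
    rewrite /a1 BP; have := B'lt P; case: (B' P) => [/(_ isT)|]; lia.
  apply: leq_sum => X _; rewrite /a1.
  by case: (B' X) (B'lt X) => [/(_ isT)|]; lia.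
- move=> X Y XY; rewrite -(aa' _ _ XY) /a1 (BE _ _ XY).
  have := BE Y X; rewrite adj_sym => /(_ XY) E; rewrite -E.
  by have := Ba X; rewrite (BE _ _ XY); have := Ba Y; lia.
- have := @swap_slab (slot_sum (fun X => a X - B X)) p q pq.
  have E1 : (fun V => slot_sum (fun X => a X - B X) V + slab p q V) = slot_sum a.
    apply/funext => V; rewrite /slot_sum /slab -big_split; apply: eq_bigr => i _.
    by rewrite /= subnK // Ba.
  have E2 : (fun V => slot_sum (fun X => a X - B X) V + slab q p V) = slot_sum a1.
    apply/funext => V; rewrite /slot_sum /slab -big_split; apply: eq_bigr => i _.
    by rewrite /=.
  by rewrite E1 E2; apply.
Qed.

Lemma refined_root (psi : node S -> nat) :
  G psi -> refined G (fun V => psi (root V)).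
Proof.
move=> Gpsi; pose a (p : node S * slot) := (p.2 == ord0) * psi p.1.
have aE v : slot_sum a v = psi v.
  rewrite /slot_sum /a (bigD1 ord0) //= mul1n big1 ?addn0 // => i.
  by move=> /negPf->.
exists (fun p _ => a p), a; split => // [V|].
  by rewrite -(aE (root V)); apply: eq_bigr.
by congr G: Gpsi; apply/funext => v; rewrite add0n aE.
Qed.

End Step.

(** * The class of one vertex *)

(** The sides have two and three elements, which is the relation 2a = 3a. *)
Definition side (i : slot) : bool := i < 2.

Definition base_adj : rel (unit * slot) := [rel p q | side p.2 != side q.2].

Lemma base_adj_sym : symmetric base_adj.
Proof. by move=> p q; rewrite /base_adj /= eq_sym. Qed.

Lemma base_adj_block p p' q q' :
  base_adj p q -> base_adj p' q -> base_adj p q' -> base_adj p' q'.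
Proof.
rewrite /base_adj /=.
by case: (side p.2) (side p'.2) (side q.2) (side q'.2) => [] [] [] [].
Qed.

Lemma base_adj_ex p : exists q, base_adj p q.
Proof.
exists (tt, if side p.2 then ord_max else ord0).
by rewrite /base_adj /=; case: (side p.2).
Qed.

Definition base : stage := Stage base_adj_sym base_adj_block base_adj_ex.

Definition level (n : nat) : stage := iter n next base.

Fixpoint unit_class (n : nat) : (node (level n) -> nat) -> Prop :=
  match n with
  | 0 => fun psi => psi tt = 1
  | m.+1 => refined (@unit_class m)
  end.

(** At stage 0, a charge of total 1 is determined by its sums over the edges,
    because both sides have at least two slots. *)
Lemma unit_class_exchangeable n : exchangeable (@unit_class n).
Proof.
elim: n => [|n IHn]; last exact: refined_exchangeable.
move=> a a' aa'; rewrite /= /slot_sum !big_ord_recl !big_ord0 /=.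
set i0 := ord0; set i1 := lift _ _; set i2 := lift _ _; set i3 := lift _ _.
set i4 := lift _ _.
have := aa' (tt, i0) (tt, i2) isT; have := aa' (tt, i0) (tt, i3) isT.
have := aa' (tt, i0) (tt, i4) isT; have := aa' (tt, i1) (tt, i2) isT.
have := aa' (tt, i1) (tt, i3) isT; have := aa' (tt, i1) (tt, i4) isT.
lia.
Qed.

Lemma not_unit_class_ge2 n (chi : node (level n) -> nat) :
  ~ unit_class (fun v => 2 + chi v).
Proof.
elim: n => [|n IHn] in chi *; first by rewrite /=; lia.
move=> /(@peel_roots _ _ (@unit_class_exchangeable n) (fun=> 0) (fun=> 2) chi).
by move=> [r [a [_ _ /IHn]]].
Qed.

(** * Inverse limits of finite sets *)

(** [R] is the field of values of the distance below, and occurs in the type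
    for the sake of the metric structure that is attached to it. *)
Record invlim (R : realType) (T : nat -> finType)
    (t : forall n, T n.+1 -> T n) := Invlim {
  coord : forall n, T n;
  coordS : forall n, t n (coord n.+1) = coord n
}.

Section InverseLimit.
Import Order.TTheory GRing.Theory Num.Theory.
Local Open Scope classical_set_scope.
Local Open Scope ring_scope.
Variables (R : realType) (T : nat -> finType) (t : forall n, T n.+1 -> T n).
Local Notation Z := (invlim R t).

HB.instance Definition _ := gen_eqMixin Z.
HB.instance Definition _ := gen_choiceMixin Z.

Lemma coord_inj (y z : Z) : (forall n, coord y n = coord z n) -> y = z.
Proof.
case: y z => [y yP] [z zP] /= yz.
have {}yz : y = z by apply: functional_extensionality_dep.
by subst y; congr Invlim; exact: Prop_irrelevance.
Qed.

Lemma coord_le m n (y z : Z) : (m <= n)%N ->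
  coord y n = coord z n -> coord y m = coord z m.
Proof.
move=> mn; rewrite -(subnK mn); elim: (n - m)%N => [//|k IHk].
by rewrite addSn => yz; apply: IHk; rewrite -[LHS]coordS -[RHS]coordS yz.
Qed.

(** The ultrametric with value 1 / (n + 1) when n is the first index at which
    the two points differ. *)
Definition lim_dist (y z : Z) : R :=
  if pselect (exists n, coord y n != coord z n) is left e
  then (ex_minn e).+1%:R^-1 else 0.

Lemma lim_dist_lt n (y z : Z) :
  lim_dist y z < n.+1%:R^-1 <-> coord y n = coord z n.
Proof.
rewrite /lim_dist; case: pselect => [e|yz]; last first.
  rewrite invr_gt0 ltr0n; split=> // _; apply/eqP; apply: contrapT => yzn.
  by apply: yz; exists n; apply/negP.
case: ex_minnP => m yzm minm; rewrite ltf_pV2 ?posrE ?ltr0n // ltr_nat ltnS.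
split=> [nm|yzn].
  by apply: contrapT => /eqP/minm; rewrite leqNgt nm.
rewrite ltnNge; apply/negP => /coord_le/(_ yzn)/eqP.
by rewrite (negPf yzm).
Qed.

Lemma lim_dist_ge n (y z : Z) :
  coord y n != coord z n -> n.+1%:R^-1 <= lim_dist y z.
Proof.
by move=> yz; rewrite leNgt; apply/negP => /lim_dist_lt/eqP; apply/negP.
Qed.

Lemma lim_dist_cases (y z : Z) : (lim_dist y z = 0 /\ y = z) \/
  exists2 n, lim_dist y z = n.+1%:R^-1 & coord y n != coord z n.
Proof.
rewrite /lim_dist; case: pselect => [e|yz].
  by right; case: ex_minnP => m yzm _; exists m.
left; split=> //; apply: coord_inj => n; apply: contrapT => /eqP yzn.
by apply: yz; exists n.
Qed.

Lemma lim_dist_ge0 (y z : Z) : 0 <= lim_dist y z.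
Proof. by case: (lim_dist_cases y z) => [[->]|[n ->]]. Qed.

Lemma lim_distxx (z : Z) : lim_dist z z = 0.
Proof. by case: (lim_dist_cases z z) => [[]//|[n _ /eqP]]. Qed.

Lemma lim_dist_positivity (y z : Z) : lim_dist y z = 0 -> y = z.
Proof.
case: (lim_dist_cases y z) => [[]//|[n -> _] /eqP].
by rewrite invr_eq0 pnatr_eq0.
Qed.

Lemma lim_dist_triangle (x y z : Z) :
  lim_dist y z <= lim_dist y x + lim_dist x z.
Proof.
case: (lim_dist_cases y z) => [[-> _]|[n -> yz]].
  by rewrite addr_ge0 ?lim_dist_ge0.
have [yx|yx] := eqVneq (coord y n) (coord x n).
  rewrite yx in yz; apply: le_trans (lim_dist_ge yz) _.
  by rewrite lerDr lim_dist_ge0.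
by apply: le_trans (lim_dist_ge yx) _; rewrite lerDl lim_dist_ge0.
Qed.

Lemma lim_dist_sym (y z : Z) : lim_dist y z = lim_dist z y.
Proof.
suff le x x' : lim_dist x x' <= lim_dist x' x by apply/eqP; rewrite eq_le !le.
case: (lim_dist_cases x x') => [[-> _]|[n -> xx']]; first exact: lim_dist_ge0.
by rewrite eq_sym in xx'; exact: lim_dist_ge.
Qed.

HB.instance Definition _ := isMetric.Build R Z lim_distxx lim_dist_positivity
  lim_dist_sym lim_dist_triangle.

Lemma nbhs_coordP (z : Z) (A : set Z) :
  nbhs z A <-> exists n, forall y, coord z n = coord y n -> A y.
Proof.
split=> [/nbhs_ballP[e /= e0 zA]|[n zA]].
  have [n ne] : exists n, n.+1%:R^-1 < e.
    exists (Num.bound e^-1); rewrite invf_plt ?posrE ?ltr0n //.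
    apply: lt_trans (archi_boundP _) _; first by rewrite invr_ge0 ltW.
    by rewrite ltr_nat.
  exists n => y zy; apply: zA; rewrite ballEmdist /=.
  by apply: lt_trans ne; apply/lim_dist_lt.
apply/nbhs_ballP; exists n.+1%:R^-1 => /=; first by rewrite invr_gt0 ltr0n.
by move=> y; rewrite ballEmdist /= => /lim_dist_lt/zA.
Qed.

Lemma open_coord n (P : set (T n)) : open [set z : Z | P (coord z n)].
Proof.
by rewrite openE => z /= Pz; apply/nbhs_coordP; exists n => y /= <-.
Qed.

Lemma clopen_coord n (P : set (T n)) : clopen [set z : Z | P (coord z n)].
Proof.
split; first exact: open_coord.
rewrite -[X in closed X]setCK; apply: open_closedC.
exact: (@open_coord n (~` P)).
Qed.

Lemma continuous_coord (h : Z -> Z) :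
  (forall n, exists m, forall y z, coord y m = coord z m ->
     coord (h y) n = coord (h z) n) ->
  continuous h.
Proof.
move=> hP z A /nbhs_coordP[n zA]; have [m hm] := hP n.
by apply/nbhs_coordP; exists m => y /hm/zA.
Qed.

Lemma clopen_basis_invlim : clopen_basis Z.
Proof.
split=> [U []//|z A /nbhs_coordP[n zA]].
exists [set y | coord z n = coord y n]; last by [].
by split=> //; exact: (clopen_coord (fun p => coord z n = p)).
Qed.

(** An ultrafilter contains, for each n, exactly one fibre of the n-th
    coordinate; these fibres are compatible and define its limit. *)
Lemma compact_invlim : compact [set: Z].
Proof.
rewrite compact_ultra => F UF _.
have FP n : exists p : T n, F [set z | coord z n = p].
  apply: contrapT => /forallNP NF.
  have : \forall z \near F, forall p : T n, coord z n <> p.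
    apply: filter_forall => p.
    by have [/NF|] := in_ultra_setVsetC [set z : Z | coord z n = p] UF.
  by move=> /filter_ex[z /(_ (coord z n))].
pose x n := sval (cid (FP n)).
have xF n : F [set z | coord z n = x n] := svalP (cid (FP n)).
have xt n : t (x n.+1) = x n.
  have /filter_ex[z [/= <- <-]] : F ([set z | coord z n.+1 = x n.+1] `&`
      [set z | coord z n = x n]) by exact: filterI.
  exact: coordS.
exists (@Invlim R T t x xt); split=> // A /nbhs_coordP[n xA].
by apply: filterS (xF n) => z /= zx; apply: xA.
Qed.

(** By compactness the precision that decides membership in U is uniform. *)
Lemma clopen_coordP (U : set Z) : clopen U ->
  exists n, forall y z, coord y n = coord z n -> U y -> U z.
Proof.
move=> [oU cU].
have /compact_near_coveringP cZ := compact_invlim.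
pose P (n : nat) (y : Z) := forall z, coord y n = coord z n -> U y -> U z.
have [|n _ /(_ n (leqnn n)) H] := cZ nat \oo P _; last first.
  by exists n => y z; apply: H.
move=> x _; have [Ux|nUx] := pselect (U x).
- have /nbhs_coordP[n xU] : nbhs x U by move: oU; rewrite openE; apply.
  exists ([set y | coord x n = coord y n], [set m | (n <= m)%N]).
    by split; [apply/nbhs_coordP; exists n|exists n].
  move=> [y m] /= [xy nm] z yz _; apply: xU.
  by rewrite xy; exact: coord_le yz.
- have /nbhs_coordP[n xU] : nbhs x (~` U).
    by have := closed_openC cU; rewrite openE; apply.
  exists ([set y | coord x n = coord y n], [set m | (n <= m)%N]).
    by split; [apply/nbhs_coordP; exists n|exists n].
  by move=> [y m] /= [xy nm] z yz /(xU _ xy).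
Qed.

End InverseLimit.

(** * Free groups *)

Section FreeGroup.
Local Open Scope group_scope.
Local Open Scope quotient_scope.
Variable I : choiceType.

Definition word_eval (H : groupType) (f : I -> H) : seq (I * bool) -> H :=
  foldr (fun l h => (if l.2 then f l.1 else (f l.1)^-1) * h) 1.

Lemma word_eval_cat (H : groupType) (f : I -> H) v w :
  word_eval f (v ++ w) = word_eval f v * word_eval f w.
Proof. by elim: v => [|l v IHv] /=; rewrite ?mul1g // IHv mulgA. Qed.

Definition word_inv (w : seq (I * bool)) : seq (I * bool) :=
  rev [seq (l.1, ~~ l.2) | l <- w].

Lemma word_eval_inv (H : groupType) (f : I -> H) w :
  word_eval f (word_inv w) = (word_eval f w)^-1.
Proof.
elim: w => [|[i b] w IHw] /=; first by rewrite invg1.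
rewrite /word_inv /= rev_cons -cats1 word_eval_cat IHw invgM /= mulg1.
by case: b => //=; rewrite invgK.
Qed.

(** Words are identified when they agree in all groups, so that equations in
    the free group, in particular its group laws, are checked by evaluation. *)
Definition word_equiv (v w : seq (I * bool)) : bool :=
  `[< forall (H : groupType) (f : I -> H), word_eval f v = word_eval f w >].

Lemma word_equiv_refl : reflexive word_equiv.
Proof. by move=> v; apply/asboolP. Qed.

Lemma word_equiv_sym : symmetric word_equiv.
Proof. by move=> v w; apply/asboolP/asboolP => vw H f; rewrite vw. Qed.

Lemma word_equiv_trans : transitive word_equiv.
Proof.
by move=> u v w /asboolP vu /asboolP uw; apply/asboolP => H f; rewrite vu.
Qed.

Canonical word_equiv_equiv :=
  EquivRel word_equiv word_equiv_refl word_equiv_sym word_equiv_trans.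

Definition free_group := {eq_quot word_equiv}.
HB.instance Definition _ := Choice.on free_group.
HB.instance Definition _ := EqQuotient.on free_group.

Definition word_class (w : seq (I * bool)) : free_group := \pi w.

Definition free_eval (H : groupType) (f : I -> H) (x : free_group) : H :=
  word_eval f (repr x).

Lemma free_eval_class (H : groupType) (f : I -> H) w :
  free_eval f (word_class w) = word_eval f w.
Proof.
rewrite /free_eval.
have /eqmodP/asboolP -> // : word_class (repr (word_class w)) = word_class w.
exact: reprK.
Qed.

Lemma free_eval_ext (x y : free_group) :
  (forall (H : groupType) (f : I -> H), free_eval f x = free_eval f y) -> x = y.
Proof.
by move=> xy; rewrite -(reprK x) -(reprK y); apply/eqmodP/asboolP.
Qed.

Definition free_one := word_class [::].
Definition free_inv (x : free_group) := word_class (word_inv (repr x)).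
Definition free_mul (x y : free_group) := word_class (repr x ++ repr y).

Lemma free_eval1 (H : groupType) (f : I -> H) : free_eval f free_one = 1.
Proof. exact: free_eval_class. Qed.

Lemma free_evalV (H : groupType) (f : I -> H) x :
  free_eval f (free_inv x) = (free_eval f x)^-1.
Proof. by rewrite free_eval_class word_eval_inv. Qed.

Lemma free_evalM (H : groupType) (f : I -> H) x y :
  free_eval f (free_mul x y) = free_eval f x * free_eval f y.
Proof. by rewrite free_eval_class word_eval_cat. Qed.

Lemma free_mulA : associative free_mul.
Proof.
by move=> x y z; apply: free_eval_ext => H f; rewrite !free_evalM mulgA.
Qed.

Lemma free_mul1 : left_id free_one free_mul.
Proof.
by move=> x; apply: free_eval_ext => H f; rewrite free_evalM free_eval1 mul1g.
Qed.

Lemma free_mulr1 : right_id free_one free_mul.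
Proof.
by move=> x; apply: free_eval_ext => H f; rewrite free_evalM free_eval1 mulg1.
Qed.

Lemma free_mulV : left_inverse free_one free_inv free_mul.
Proof.
move=> x; apply: free_eval_ext => H f.
by rewrite free_evalM free_evalV free_eval1 mulVg.
Qed.

Lemma free_mulVr : right_inverse free_one free_inv free_mul.
Proof.
move=> x; apply: free_eval_ext => H f.
by rewrite free_evalM free_evalV free_eval1 mulgV.
Qed.

HB.instance Definition _ := isGroup.Build free_group
  free_mulA free_mul1 free_mulr1 free_mulV free_mulVr.

Definition free_gen (i : I) : free_group := word_class [:: (i, true)].

Lemma free_eval_gen (H : groupType) (f : I -> H) i :
  free_eval f (free_gen i) = f i.
Proof. by rewrite free_eval_class /= mulg1. Qed.

Lemma free_group_basis : free_basis free_gen.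
Proof.
move=> H f; exists (free_eval f); split.
  by split; [exact: free_evalM|exact: free_eval_gen].
move=> phi [phiM phif]; apply/funext => x.
have phi1 : phi 1 = 1 by apply: (mulgI (phi 1)); rewrite -phiM !mulg1.
have phiV y : phi y^-1 = (phi y)^-1.
  by apply: (mulgI (phi y)); rewrite -phiM !mulgV phi1.
rewrite -(reprK x) -/(word_class (repr x)) free_eval_class.
elim: (repr x) => [|[i b] w IHw] /=; first by rewrite -phi1.
have -> : word_class ((i, b) :: w) =
    (if b then free_gen i else (free_gen i)^-1) * word_class w.
  apply: free_eval_ext => K g; rewrite free_evalM !free_eval_class /=.
  by congr (_ * _); case: b; rewrite ?free_evalV free_eval_gen.
by rewrite phiM -IHw -phif; congr (_ * _); case: b; rewrite ?phiV.
Qed.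

End FreeGroup.

(** * Actions of free groups by homeomorphisms *)

Section HomeoGroup.
Local Open Scope classical_set_scope.
Variable Z : topologicalType.

Record homeo := Homeo {
  homeo_fun :> Z -> Z;
  homeo_inv : Z -> Z;
  homeoK : cancel homeo_fun homeo_inv;
  homeoVK : cancel homeo_inv homeo_fun;
  homeo_continuous : continuous homeo_fun;
  homeo_inv_continuous : continuous homeo_inv
}.

HB.instance Definition _ := gen_eqMixin homeo.
HB.instance Definition _ := gen_choiceMixin homeo.

Lemma homeo_ext (g h : homeo) : g =1 h -> g = h.
Proof.
case: g h => [g g' gK g'K gc g'c] [h h' hK h'K hc h'c] /= gh.
have {}gh : g = h by apply/funext.
have gh' : g' = h'.
  by apply/funext => z; apply: (can_inj hK); rewrite -{1}gh g'K h'K.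
by subst h h'; congr Homeo; exact: Prop_irrelevance.
Qed.

Definition homeo1 : homeo :=
  @Homeo id id (fun=> erefl) (fun=> erefl) (fun z => @cvg_id _ _)
    (fun z => @cvg_id _ _).

Definition homeoV (g : homeo) : homeo :=
  Homeo (@homeoVK g) (@homeoK g) (@homeo_inv_continuous g) (@homeo_continuous g).

Definition homeoM (g h : homeo) : homeo :=
  Homeo (can_comp (@homeoK g) (@homeoK h)) (can_comp (@homeoVK h) (@homeoVK g))
    (fun z => continuous_comp (@homeo_continuous h z) (@homeo_continuous g _))
    (fun z => continuous_comp (@homeo_inv_continuous g z)
      (@homeo_inv_continuous h _)).

Lemma homeoMA : associative homeoM.
Proof. by move=> f g h; apply: homeo_ext. Qed.
Lemma homeoM1 : left_id homeo1 homeoM.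
Proof. by move=> g; apply: homeo_ext. Qed.
Lemma homeoMr1 : right_id homeo1 homeoM.
Proof. by move=> g; apply: homeo_ext. Qed.
Lemma homeoMV : left_inverse homeo1 homeoV homeoM.
Proof. by move=> g; apply: homeo_ext => z; exact: homeoK. Qed.
Lemma homeoMVr : right_inverse homeo1 homeoV homeoM.
Proof. by move=> g; apply: homeo_ext => z; exact: homeoVK. Qed.

HB.instance Definition _ := isGroup.Build homeo
  homeoMA homeoM1 homeoMr1 homeoMV homeoMVr.

Definition free_action (I : choiceType) (f : I -> homeo) :
    homeo_action (free_group I) Z.
Proof.
exists (fun x => free_eval f x : Z -> Z).
- by move=> z; rewrite [free_eval f _]free_eval1.
- by move=> s t z; rewrite [free_eval f _]free_evalM.
- by move=> t; exact: homeo_continuous.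
Defined.

End HomeoGroup.

(** * The space of configurations *)

Section Space.
Variable R : realType.

Definition pt (n : nat) : finType := (node (level n) * slot)%type.

Definition config : Type := invlim R (T := pt) (fun n => @trunc (level n)).
HB.instance Definition _ := Metric.on config.

Lemma trunc_coord (z : config) n : @trunc (level n) (coord z n.+1) = coord z n.
Proof. exact: coordS z n. Qed.

(** The new base point at precision n is read off at precision n + 1. *)
Definition crossing (z : config) (n : nat) : pt n :=
  @cross (level n) (coord z n.+1).

Lemma trunc_crossing z n :
  @trunc (level n) (crossing z n.+1) = crossing z n.
Proof.
have := @adj_cross (level n.+1) (coord z n.+2).
by rewrite trunc_coord => /andP[/eqP <-].
Qed.

Definition flip (z : config) : config := Invlim R (trunc_crossing z).

Lemma flipK : involutive flip.
Proof.
move=> z; apply: coord_inj => n.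
have := @adj_cross (level n.+1) (coord z n.+2).
by rewrite trunc_coord => /andP[_ /eqP]; rewrite trunc_coord.
Qed.

Lemma flip_continuous : continuous flip.
Proof.
apply: continuous_coord => n; exists n.+1 => y z yz.
by rewrite /coord /= /crossing yz.
Qed.

Definition turning (g : slot -> slot) (z : config) (n : nat) : pt n :=
  ((coord z n).1, g (coord z n).2).

Lemma trunc_turning g z n :
  @trunc (level n) (turning g z n.+1) = turning g z n.
Proof. by rewrite /turning -(trunc_coord z n). Qed.

Definition turn (g : slot -> slot) (z : config) : config :=
  Invlim R (trunc_turning g z).

Lemma turnK g h : cancel g h -> cancel (turn g) (turn h).
Proof.
move=> gh z; apply: coord_inj => n; rewrite /coord /= /turning /= gh.
by rewrite /coord /= -surjective_pairing.
Qed.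

Lemma turn_continuous g : continuous (turn g).
Proof.
apply: continuous_coord => n; exists n => y z yz.
by rewrite /coord /= /turning yz.
Qed.

Definition flip_homeo : homeo config :=
  Homeo flipK flipK flip_continuous flip_continuous.

Definition turn_homeo : homeo config :=
  Homeo (turnK (@ordSK 5)) (turnK (@ord_predK 5))
    (@turn_continuous _) (@turn_continuous _).

(** A compatible sequence with a given n-th term is built from one that passes
    through the truncation of this term, extended upwards by arbitrary
    choices. *)
Lemma coord_surj n (p : pt n) : exists z : config, coord z n = p.
Proof.
have lift m (q : pt m) : exists P : pt m.+1, @trunc (level m) P = q.
  have [q' qq'] := adj_ex q; have [P Pq _] := @adj_extend (level m) q q' qq'.
  by exists P.
pose up m q := sval (cid (lift m q)).
have upK m q : @trunc (level m) (up m q) = q := svalP (cid (lift m q)).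
elim: n p => [|n IHn] p.
  pose z := fix z m : pt m := if m is k.+1 then up k (z k) else p.
  by exists (@Invlim R pt (fun n => @trunc (level n)) z (fun n => upK n (z n))).
have [y yn] := IHn (@trunc (level n) p).
pose d := dfwith (fun m => coord y m) n.+1 p.
pose z := fix z m : pt m :=
  if m is k.+1 then (if (k <= n)%N then d k.+1 else up k (z k)) else d 0.
have zd m : (m <= n.+1)%N -> z m = d m by case: m => //= m; rewrite ltnS => ->.
have zz m : @trunc (level m) (z m.+1) = z m.
  rewrite [z m.+1]/=; case: leqP => [mn|_]; last exact: upK.
  rewrite zd; last by rewrite leqW.
  move: mn; rewrite leq_eqVlt => /orP[/eqP->|mn].
    rewrite /d dfwithin dfwithout ?yn //; by rewrite neq_ltn ltnSn orbT.
  rewrite /d !dfwithout ?trunc_coord //; rewrite neq_ltn ?ltnS ?mn ?orbT //.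
  by rewrite (ltnW mn) orbT.
exists (Invlim R zz); rewrite /coord /= /d; by rewrite leqnn dfwithin.
Qed.

HB.instance Definition _ := isPointed.Build config
  (sval (cid (@coord_surj 0 (tt, ord0)))).

End Space.

(** * The class of A in the type semigroup *)

Lemma slot_sum_eq (V : eqType) (i : slot) (v : V) :
  slot_sum (fun p => p.2 == i) v = 1.
Proof.
rewrite -[RHS](congr1 nat_of_bool (eqxx v)) -(sum_slot_eq v v i).
by apply: eq_bigr => j _; rewrite xpair_eqE eqxx.
Qed.

Lemma ereal_double_eq_triple (R : realDomainType) (x : \bar R) :
  (0 < x)%E -> (x + x = x + (x + x))%E -> x = +oo%E.
Proof.
case: x => [r| |] //; rewrite lte_fin => r0 /eqP.
by rewrite -!EFinD eqe => /eqP rr; exfalso; lra.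
Qed.

Section Charge.
Local Open Scope classical_set_scope.
Variable R : realType.
Local Notation Z := (config R).

Definition ind (C : set Z) (z : Z) : nat := `[< C z >].

Definition factors (n : nat) (phi : Z -> nat) (a : pt n -> nat) : Prop :=
  forall z, phi z = a (coord z n).

Lemma factorsS n phi a : @factors n phi a ->
  @factors n.+1 phi (fun p => a (@trunc (level n) p)).
Proof. by move=> phia z; rewrite trunc_coord. Qed.

Lemma factors_le m n phi (a : pt m -> nat) : m <= n ->
  factors phi a -> exists b : pt n -> nat, factors phi b.
Proof.
move=> mn; rewrite -(subnK mn); elim: (n - m) => [|k IHk] phia; first by exists a.
by have [b /factorsS] := IHk phia; eexists; eassumption.
Qed.

Lemma factors_unique n phi (a b : pt n -> nat) :
  factors phi a -> factors phi b -> a = b.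
Proof.
move=> phia phib; apply/funext => p; have [z <-] := coord_surj R p.
by rewrite -phia -phib.
Qed.

Definition locally_const (phi : Z -> nat) : Prop :=
  exists n (a : pt n -> nat), factors phi a.

Lemma locally_constD phi psi : locally_const phi -> locally_const psi ->
  locally_const (fun z => phi z + psi z).
Proof.
move=> [m [a phia]] [n [b psib]].
have [a' phia'] := factors_le (leq_maxl m n) phia.
have [b' psib'] := factors_le (leq_maxr m n) psib.
by exists (maxn m n), (fun p => a' p + b' p) => z; rewrite phia' psib'.
Qed.

Lemma locally_const_ind C : clopen C -> locally_const (ind C).
Proof.
move=> /clopen_coordP[n Cn]; exists n.
exists (fun p => `[< exists2 z, coord z n = p & C z >] : nat) => z.
congr nat_of_bool; apply/asboolP/asboolP => [Cz|[y yz Cy]]; first by exists z.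
exact: Cn yz Cy.
Qed.

Lemma locally_const_sum (I : Type) (s : seq I) (phi : I -> Z -> nat) :
  (forall i, locally_const (phi i)) ->
  locally_const (fun z => \sum_(i <- s) phi i z).
Proof.
move=> phiP; elim: s => [|i s IHs].
  by exists 0, (fun=> 0) => z; rewrite big_nil.
have -> : (fun z => \sum_(j <- i :: s) phi j z) =
    (fun z => phi i z + \sum_(j <- s) phi j z).
  by apply/funext => z; rewrite big_cons.
exact: locally_constD.
Qed.

(** The functions on the space that represent the class of A. By
    [unital_le] the stage is immaterial. *)
Definition unital (phi : Z -> nat) : Prop :=
  exists n (a : pt n -> nat), factors phi a /\ unit_class (slot_sum a).

Lemma unital_le m n phi (a : pt m -> nat) : m <= n ->
  factors phi a -> unit_class (slot_sum a) ->
  forall b : pt n -> nat, factors phi b -> unit_class (slot_sum b).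
Proof.
move=> mn; rewrite -(subnK mn); elim: (n - m) => [|k IHk] phia ga b phib.
  by rewrite -(factors_unique phia phib).
have [c phic] := factors_le (leq_addl k m) phia.
have gc := IHk phia ga _ phic.
by rewrite (factors_unique phib (factorsS phic)); exact: refined_root gc.
Qed.

Definition preserves_unital (h : homeo Z) : Prop :=
  forall phi C, locally_const phi -> clopen C ->
    unital (fun z => phi z + ind C z) ->
    unital (fun z => phi z + ind (homeo_inv h @^-1` C) z).

Lemma unital_common phi C : locally_const phi -> clopen C ->
  unital (fun z => phi z + ind C z) ->
  exists n (a c : pt n -> nat), [/\ factors phi a, factors (ind C) c &
    unit_class (slot_sum (fun p => a p + c p))].
Proof.
move=> [n1 [a1 phia1]] /locally_const_ind[n2 [c2 Cc2]] [n3 [b3 [b3P gb3]]].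
pose n := maxn n1 (maxn n2 n3).
have [a phia] : exists a : pt n -> nat, factors phi a.
  by apply: factors_le phia1; rewrite leq_maxl.
have [c Cc] : exists c : pt n -> nat, factors (ind C) c.
  by apply: factors_le Cc2; rewrite !leq_max leqnn orbT.
exists n, a, c; split => //; apply: unital_le b3P gb3 _ _.
  by rewrite !leq_max leqnn !orbT.
by move=> z; rewrite phia Cc.
Qed.

(** The indicators of C and of its flip have the same sum over each edge of the
    stage that follows the one where C is determined. *)
Lemma flip_preserves_unital : preserves_unital (flip_homeo R).
Proof.
move=> phi C phiP cC /(unital_common phiP cC)[n [a [c [phia Cc gac]]]].
exists n.+1, (fun P => a (@trunc (level n) P) + c (@cross (level n) P)).
split=> [z|]; first by rewrite trunc_coord -phia -[ind _ z]/(ind C (flip z)) Cc.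
have gt : @unit_class n.+1 (slot_sum (fun P => a (@trunc (level n) P) +
    c (@trunc (level n) P))) := refined_root gac.
apply: (@unit_class_exchangeable n.+1 _ _ _ gt) => P Q.
by move=> /andP[/eqP -> /eqP ->]; rewrite addnACA [RHS]addnACA [X in _ + X]addnC.
Qed.

Lemma turn_preserves_unital (g h : slot -> slot) (gh : cancel g h)
    (hg : cancel h g) :
  preserves_unital
    (Homeo (turnK gh) (turnK hg) (turn_continuous (g := g))
       (turn_continuous (g := h)) : homeo Z).
Proof.
move=> phi C phiP cC /(unital_common phiP cC)[n [a [c [phia Cc gac]]]].
exists n, (fun p => a p + c (p.1, h p.2)); split=> [z|].
  by rewrite -phia -[ind _ z]/(ind C (turn h z)) Cc.
suff -> : slot_sum (fun p : pt n => a p + c (p.1, h p.2)) =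
    slot_sum (fun p => a p + c p) by [].
apply/funext => v; rewrite /slot_sum !big_split /=; congr addn.
by rewrite [RHS](reindex h) //; exists g => i _.
Qed.

Definition generator (i : 'I_2) : homeo Z :=
  if i == ord0 then flip_homeo R else turn_homeo R.

Lemma generator_preserves_unital i :
  preserves_unital (generator i) /\ preserves_unital (generator i)^-1%g.
Proof.
rewrite /generator; case: eqP => _; split.
- exact: flip_preserves_unital.
- exact: flip_preserves_unital.
- exact: turn_preserves_unital.
- exact: (turn_preserves_unital (@ord_predK 5) (@ordSK 5)).
Qed.

Lemma clopen_homeo (h : homeo Z) (C : set Z) :
  clopen C -> clopen (homeo_inv h @^-1` C).
Proof.
move=> [oC cC]; split.
  by apply: open_comp oC => z _; exact: homeo_inv_continuous.
by apply: closed_comp cC => z _; exact: homeo_inv_continuous.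
Qed.

Lemma word_preserves_unital w : preserves_unital (word_eval generator w).
Proof.
elim: w => [|[i b] w IHw] phi C phiP cC gC //=.
have [p pV] := generator_preserves_unital i.
have cC' := clopen_homeo (word_eval generator w) cC.
have := IHw phi C phiP cC gC.
case: b => /=; [exact: p phiP cC'|exact: pV phiP cC'].
Qed.

Definition config_action : homeo_action (free_group 'I_2) Z :=
  free_action generator.

Lemma action_unital t phi C : locally_const phi -> clopen C ->
  unital (fun z => phi z + ind C z) ->
  unital (fun z => phi z + ind (config_action t @` C) z).
Proof.
move=> phiP cC gC; have := @word_preserves_unital (repr t) _ _ phiP cC gC.
rewrite act_image.
suff -> : config_action t^-1%g =
  homeo_inv (word_eval generator (repr t)) :> (Z -> Z) by [].
have tV : free_eval generator t^-1%g = (free_eval generator t)^-1%g.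
  exact: free_evalV.
by rewrite /config_action /= tV.
Qed.

Lemma action_unital_sum (I : Type) (s : seq I) (C : I -> clopens Z)
    (t : I -> free_group 'I_2) phi : locally_const phi ->
  unital (fun z => phi z + \sum_(k <- s) ind (C k) z) ->
  unital (fun z => phi z + \sum_(k <- s) ind (config_action (t k) @` C k) z).
Proof.
elim: s phi => [|k s IHs] phi phiP.
  by congr unital; apply/funext => z; rewrite !big_nil.
have -> : (fun z => phi z + \sum_(j <- k :: s) ind (C j) z) =
    (fun z => (phi z + \sum_(j <- s) ind (C j) z) + ind (C k) z).
  by apply/funext => z; rewrite big_cons addnCA addnC.
have cC j : locally_const (ind (C j)) := locally_const_ind (clopen_setP (C j)).
move=> /(@action_unital (t k)) gk.
have -> : (fun z => phi z +
      \sum_(j <- k :: s) ind (config_action (t j) @` C j) z) =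
    (fun z => (phi z + ind (config_action (t k) @` C k) z) +
       \sum_(j <- s) ind (config_action (t j) @` C j) z).
  by apply/funext => z; rewrite big_cons addnA.
apply: IHs.
  apply: locally_constD => //; apply: locally_const_ind.
  exact/clopen_act_image/clopen_setP.
have -> : (fun z => phi z + ind (config_action (t k) @` C k) z +
      \sum_(j <- s) ind (C j) z) =
    (fun z => phi z + \sum_(j <- s) ind (C j) z +
      ind (config_action (t k) @` C k) z).
  by apply/funext => z; rewrite addnAC.
apply: gk; last exact: clopen_setP.
by apply: locally_constD => //; exact: locally_const_sum.
Qed.

Definition at_slot (i : slot) : set Z := [set z | (coord z 0).2 = i].

Lemma clopen_at_slot i : clopen (at_slot i).
Proof. exact: (@clopen_coord R pt _ 0 (fun p => p.2 = i)). Qed.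

Definition slot0 : clopens Z := mk_clopens (clopen_at_slot ord0).

Lemma coord_slot (z : Z) n : (coord z n).2 = (coord z 0).2.
Proof. by elim: n => // n <-; rewrite -(trunc_coord z n). Qed.

Lemma unital_at_slot i : unital (ind (at_slot i)).
Proof.
exists 0, (fun p => p.2 == i); split=> [z|]; last exact: slot_sum_eq.
by congr nat_of_bool; apply/asboolP/eqP.
Qed.

(** An equidecomposition of A with two copies of A and a remainder writes the
    indicator of A as a sum of indicators of pieces; the sum of the indicators
    of the moved pieces is at least 2 on A and would still be unital. *)
Lemma not_paradoxical : ~ paradoxical config_action slot0.
Proof.
move=> [x]; rewrite -(ts_class_repr x) GRing.mulr2n; move: (repr x) => s E.
have /ts_classP : ts_class config_action (([:: slot0] ++ [:: slot0]) ++ s) =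
    ts_class config_action [:: slot0].
  by rewrite -!ts_addE.
move=> /equidecomposable_sym/equidecomposableP[l [C [t [n [m [XE Xt YE Yt]]]]]].
have stack_slot0 z i : stack [:: slot0] (z, i) <-> at_slot ord0 z /\ i = 1.
  rewrite stackP; split=> [[k]|[Az ->]]; last by exists ord0.
  by rewrite [k]ord1.
have sumC : (fun z => 0 + \sum_(k <- enum 'I_l) ind (C k) z) = ind slot0.
  apply/funext => z; rewrite add0n /ind; case: asboolP => [Az|nAz].
    have /XE[k [Ck nk]] : stack [:: slot0] (z, 1) by apply/stack_slot0.
    rewrite big_enum /= (bigD1 k) //= big1 => [|k' k'k]; first by rewrite asboolT.
    rewrite asboolF // => Ck'.
    have /stack_slot0[_ nk'] : stack [:: slot0] (z, n k').
      by apply/XE; exists k'.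
    by move/eqP: k'k; apply; apply: Xt Ck' Ck _; rewrite nk'.
  rewrite big1 // => k _; rewrite asboolF // => Ck.
  have /stack_slot0[] // : stack [:: slot0] (z, n k) by apply/XE; exists k.
have const0 : locally_const (fun _ : Z => 0) by exists 0, (fun=> 0).
have := @action_unital_sum _ (enum 'I_l) C t _ const0.
rewrite sumC => /(_ (unital_at_slot ord0)) [N [b [bE gb]]].
apply: (@not_unit_class_ge2 N (slot_sum (fun p => b p - 2 * (p.2 == ord0)))).
suff -> : (fun v => 2 + slot_sum (fun p : pt N => b p - 2 * (p.2 == ord0)) v) =
  slot_sum b by [].
apply/funext => v.
transitivity (2 * slot_sum (fun p : pt N => p.2 == ord0) v +
    slot_sum (fun p : pt N => b p - 2 * (p.2 == ord0)) v).
  by rewrite slot_sum_eq.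
rewrite /slot_sum big_distrr -big_split; apply: eq_bigr => i _ /=.
rewrite subnKC //; case: eqP => //= i0; rewrite muln1.
have [z zv] := @coord_surj R N (v, i); rewrite -zv -bE add0n.
have Az : at_slot ord0 z by rewrite /at_slot /= -(coord_slot z N) zv.
have stack_slot0s j : j < 2 -> stack (([:: slot0] ++ [:: slot0]) ++ s) (z, j.+1).
  move=> j2; apply/stack_cat; left; apply/stackP; exists (Ordinal j2).
  by split=> //; case: j j2 => [|[]].
have /YE[k1 [Ck1 mk1]] := stack_slot0s 0 isT.
have /YE[k2 [Ck2 mk2]] := stack_slot0s 1 isT.
have k21 : k2 != k1 by apply/eqP => k21; move: mk1; rewrite -k21 -mk2.
rewrite big_enum /= (bigD1 k1) //= (bigD1 k2) //= /ind.
rewrite !asboolT ?addnA ?leq_addr //.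
- exact: (act_imageP config_action _ _ _).2 Ck2.
- exact: (act_imageP config_action _ _ _).2 Ck1.
Qed.

(** With x the measure of A, the two sides have measures 2x and 3x, and the flip
    exchanges them. *)
Lemma infinite_measure (mu : {content set (clopen_algebra Z) -> \bar R}%R) :
  invariant_content config_action mu -> (0 < mu slot0)%E -> mu slot0 = +oo%E.
Proof.
move=> muI.
have muU U V : clopen U -> clopen V -> U `&` V = set0 ->
    mu (U `|` V) = (mu U + mu V)%E.
  move=> cU cV UV; exact: (@measureU _ R (clopen_algebra Z) mu U V cU cV UV).
have generatorE i : config_action (free_gen i) = generator i :> (Z -> Z).
  by rewrite /config_action /=; congr homeo_fun; exact: free_eval_gen.
have turnE i : turn_homeo R @` at_slot i = at_slot (ordS i).
  apply/seteqP; split=> [_ [z <- <-] //|z zi].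
  exists (homeo_inv (turn_homeo R) z); last exact: homeoVK.
  by move: zi; rewrite /at_slot /= /turning /= => ->; rewrite ordSK.
have muS i : mu (at_slot (ordS i)) = mu (at_slot i).
  rewrite -turnE -(muI (free_gen 1%R) (at_slot i)) ?generatorE //.
  exact: clopen_at_slot.
pose at_side b : set Z := [set z | side (coord z 0).2 = b].
have at_sideC b : clopen (at_side b).
  exact: (@clopen_coord R pt _ 0 (fun p => side p.2 = b)).
have side_flip (z : Z) : side (coord (flip z) 0).2 = ~~ side (coord z 0).2.
  have := @adj_cross (level 0) (coord z 1); rewrite trunc_coord.
  by rewrite /= /base_adj /=; case: (side _); case: (side _).
have flipE : flip_homeo R @` at_side true = at_side false.
  apply/seteqP; split=> [_ [z zs <-]|z zs].
    by rewrite /at_side /= side_flip zs.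
  exists (flip z); last exact: flipK.
  by rewrite /at_side /= side_flip zs.
pose i1 := ordS (ord0 : slot); pose i2 := ordS i1; pose i3 := ordS i2.
pose i4 := ordS i3.
have slot_disj i j : i != j -> at_slot i `&` at_slot j = set0.
  move=> ij; apply/seteqP; split=> // z [zi zj]; case/eqP: ij.
  exact: etrans (esym zi) zj.
have sideT : at_side true = at_slot ord0 `|` at_slot i1.
  apply/seteqP; split=> z; last by case; exact: (congr1 side).
  rewrite /at_side /at_slot /=; case: (coord z 0) => v [[|[|k]] ?] //= _.
    by left; apply/val_inj.
  by right; apply/val_inj.
have sideF : at_side false = at_slot i2 `|` (at_slot i3 `|` at_slot i4).
  apply/seteqP; split=> z; last by case=> [|[]]; exact: (congr1 side).
  rewrite /at_side /at_slot /=; case: (coord z 0) => v [[|[|[|[|[|k]]]]] ?] //= _.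
  - by left; apply/val_inj.
  - by right; left; apply/val_inj.
  - by right; right; apply/val_inj.
have c := clopen_at_slot.
have mu2 : mu (at_side true) = (mu slot0 + mu slot0)%E.
  by rewrite sideT muU // ?slot_disj // /i1 muS.
have mu3 : mu (at_side false) = (mu slot0 + (mu slot0 + mu slot0))%E.
  rewrite sideF muU ?muU //.
  - by rewrite /i4 /i3 /i2 /i1 !muS.
  - exact: slot_disj.
  - by case: (c i3) (c i4) => [? ?] [? ?]; split; [exact: openU|exact: closedU].
  - by rewrite setIUr !slot_disj // setU0.
move=> /ereal_double_eq_triple; apply; rewrite -mu3 -mu2 -flipE.
by rewrite -(muI (free_gen 0%R) (at_side true)) ?generatorE.
Qed.

End Charge.

Local Open Scope classical_set_scope.
Local Open Scope ring_scope.
Local Open Scope ereal_scope.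

Theorem corollary7p12 (R : realType) :
  exists (F : groupType) (Z : ptopologicalType) (theta : homeo_action F Z)
      (A : clopens Z),
    [/\ fg_free_group F,
        [/\ compact [set: Z], metrizable R Z & clopen_basis Z],
        ~ paradoxical theta A &
        forall mu : {content set (clopen_algebra Z) -> \bar R},
          invariant_content theta mu -> 0 < mu A -> mu A = +oo].
Proof.
exists (free_group 'I_2), (config R), (config_action R), (slot0 R); split.
- by exists 2%N, (@free_gen _); exact: free_group_basis.
- split; [exact: compact_invlim| |exact: clopen_basis_invlim].
  by exists (config R), id, id; split => // z; exact: cvg_id.
- exact: not_paradoxical.
- exact: infinite_measure.
Qed.
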